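(* Let $E$ be a real Banach space, let $S=\{S(t)\}_{t\ge 0}$ be a $C_0$-semigroup on $E$ with generator $A$, let $B$ be a bounded linear operator from a real Hilbert space $H$ into $E$, let $P$ be the associated Ornstein-Uhlenbeck semigroup and $P^\circ$ its restriction to $BUC^\circ(E)$. If $t,s\ge 0$ are such that $S(t)=S(s)$ and $\|P^\circ(t)-P^\circ(s)\|_{\mathcal{L}(BUC^\circ(E))}=2$, then $\mu_t\perp\mu_s$.
   Context: Setting. $E^*$ is the dual of $E$; $Q:=BB^*\in\mathcal{L}(E^*,E)$ (with $H$ identified with its dual). For $t\ge 0$, $Q_t\in\mathcal{L}(E^*,E)$ is given by $\langle Q_tx^*,y^*\rangle=\int_0^t\langle S(s)BB^*S^*(s)x^*,y^*\rangle\,ds$ for $x^*,y^*\in E^*$. Standing assumption: for each $t\ge 0$ there is a centred Gaussian Radon measure $\mu_t$ on $E$ with covariance operator $Q_t$, i.e. a Radon probability measure under which every $x^*\in E^*$ is a centred Gaussian random variable with variance $\langle Q_tx^*,x^*\rangle$ (so $\mu_0=\delta_0$). The Ornstein-Uhlenbeck semigroup is $P(t)f(x)=\int_E f(S(t)x+y)\,d\mu_t(y)$ for bounded real-valued continuous $f$ on $E$. $BUC(E)$ is the space of bounded real-valued uniformly continuous functions on $E$ with the supremum norm; it is $P$-invariant. $BUC^\circ(E):=\{f\in BUC(E):\lim_{t\downarrow0}\|P(t)f-f\|=0\}$, a closed $P$-invariant subspace, and $P^\circ$ is the restriction of $P$ to it. $\mathcal{L}(X)$ carries the uniform operator norm.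 $\mu\perp\nu$ means that there are disjoint measurable sets $C,D$ with $\mu(C)=\nu(D)=1$. *)

(* Defs.v *)
From HB Require Import structures.
From mathcomp Require Import all_boot all_order all_algebra.
From mathcomp Require Import sesquilinear.
From mathcomp Require Import all_classical all_reals all_analysis.

Set Implicit Arguments.
Unset Strict Implicit.
Unset Printing Implicit Defensive.

Import Order.TTheory GRing.Theory Num.Theory.
Import numFieldNormedType.Exports.

Local Open Scope classical_set_scope.
Local Open Scope ring_scope.

Section Operators.
Context {R : realType}.

(* [linear_bounded_continuous] identifies continuity with boundedness for
   linear maps. *)
Definition bounded_operator (U V : normedModType R) : set (U -> V) :=
  [set T : U -> V | linear T /\ continuous T].

Definition dual_space (U : normedModType R) : set (U -> R) :=
  [set x : U -> R | scalar x /\ continuous x].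

(* The values [S t] for t < 0 are irrelevant. *)
Definition C0_semigroup (E : normedModType R) (S : R -> E -> E) : Prop :=
  [/\ forall t, 0 <= t -> bounded_operator (S t),
      S 0 = id,
      forall t s, 0 <= t -> 0 <= s -> S (t + s) = S t \o S s &
      forall x, S t x @[t --> 0^'+] --> x].

(* An unbounded operator is represented by its graph. *)
Definition generator (E : normedModType R) (S : R -> E -> E) : set (E * E) :=
  [set p | h^-1 *: (S h p.1 - p.1) @[h --> 0^'+] --> p.2].

(* H is a real Hilbert space when it is complete (by its type) and its norm
   is induced by the inner product [dot]. *)
Definition induces_norm (H : normedModType R) (dot : {dot H for idfun}) : Prop :=
  forall h, `|h| ^+ 2 = dot h h.

(* [adjoint dot B x] is B^* x^* seen in H; for x^* in the dual and B bounded,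
   the Riesz theorem gives exactly one such element. *)
Definition adjoint (H E : normedModType R) (dot : {dot H for idfun})
    (B : H -> E) (x : E -> R) : H :=
  xget 0 [set h | forall k, dot k h = x (B k)].

(* [covariance_operator dot S B t x] is Q_t x^*, the unique z in E with
   <z, y^*> = \int_0^t <S(u) B B^* S^*(u) x^*, y^*> du for all y^*; here
   S^*(u) x^* is [x \o S u]. *)
Definition covariance_operator (H E : normedModType R) (dot : {dot H for idfun})
    (S : R -> E -> E) (B : H -> E) (t : R) (x : E -> R) : E :=
  xget 0 [set z | forall y, dual_space y ->
    y z = \int[lebesgue_measure]_(u in `[0, t])
            y (S u (B (adjoint dot B (x \o S u))))].

End Operators.

Notation borel T := (g_sigma_algebraType (@open T)).

Section Measures.
Context {R : realType}.

(* The library's [normal_prob 0 0] is not the Dirac measure at 0 but the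
   uniform law on [0, 1], whence the case distinction. *)
Definition centred_gaussian (v : R) : set R -> \bar R :=
  if v == 0 then \d_(0 : R) else normal_prob 0 (Num.sqrt v).

Definition radon (T : ptopologicalType) (mu : probability (borel T) R) : Prop :=
  forall A : set (borel T), measurable A ->
    mu A = ereal_sup [set mu K | K in [set K | @compact T K /\ K `<=` A]].

Definition gaussian_radon (E : normedModType R) (mu : probability (borel E) R)
    (Q : (E -> R) -> E) : Prop :=
  radon mu /\
  forall x, dual_space x -> forall A : set R, measurable A ->
    mu (x @^-1` A) = centred_gaussian (x (Q x)) A.

Definition mutually_singular d (T : measurableType d) (mu nu : probability T R)
    : Prop :=
  exists C D : set T,
    [/\ measurable C, measurable D, C `&` D = set0, mu C = 1%E & nu D = 1%E].

End Measures.

Section OrnsteinUhlenbeck.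
Context {R : realType}.

Definition sup_norm (T : Type) (f : T -> R) : R := sup (range (fun x => `|f x|)).

(* The norm of an operator T on a subspace X of the bounded functions with
   the supremum norm. *)
Definition op_norm (U : Type) (X : set (U -> R)) (T : (U -> R) -> (U -> R)) : R :=
  sup [set sup_norm (T f) | f in [set f | X f /\ sup_norm f <= 1]].

Variables (E : normedModType R) (S : R -> E -> E).
Variable (mu : R -> probability (borel E) R).

Definition OU (t : R) (f : E -> R) (x : E) : R :=
  \int[mu t]_y f (S t x + y).

Definition BUC : set (E -> R) := [set f | bounded_fun f /\ unif_continuous f].

Definition BUC0 : set (E -> R) :=
  [set f | BUC f /\ sup_norm (OU t f \- f) @[t --> 0^'+] --> (0 : R)].

End OrnsteinUhlenbeck.

(* Main.v *)
(** Only the value of the norm and [S t = S s] matter, Gaussianity does not.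
    Translating nearly optimal [f] by [S t x = S s x] gives measurable [g] with
    [|g| <= 1] and [\int g d(mu_t) - \int g d(mu_s)] as close to 2 as desired.
    Then [1 - g] has small [mu_t]-integral and [1 + g] small [mu_s]-integral, so
    [{g <= 0}] is almost null for [mu_t] and its complement for [mu_s]; the
    upper limit of such sets along summable errors separates the measures by
    the Borel-Cantelli lemma. *)
Require Import Defs.
From mathcomp Require Import all_boot all_order all_algebra.
From mathcomp Require Import sesquilinear.
From mathcomp Require Import all_classical all_reals all_analysis.
From mathcomp Require Import lra.
Import Order.TTheory GRing.Theory Num.Theory.
Import numFieldNormedType.Exports.
Local Open Scope classical_set_scope.
Local Open Scope ring_scope.

(** Open intervals generate the Borel sets of the line, and their preimages under [f] are open. *)
Lemma continuous_borel_measurable (R : realType) (T : ptopologicalType)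
    (f : T -> R) : continuous f -> measurable_fun setT (f : borel T -> R).
Proof.
move=> /continuousP cf; apply: (measurability _ (measurable_realfun.RGenOpens.measurableE R)).
move=> _ [_ [a [b ->] <-]]; rewrite setTI; apply: sub_sigma_algebra.
exact/cf/interval_open.
Qed.

Lemma unif_continuous_continuous (R : realType) (U V : pseudoMetricType R)
    (f : U -> V) : unif_continuous f -> continuous f.
Proof.
move=> /unif_continuousP cf x; apply/cvg_ballP => e e0.
have [d d0 xf] := cf e e0.
by near do apply: (xf (x, _)); exact: nbhsx_ballx.
Unshelve. all: by end_near. Qed.

Lemma integrable_norm_le1 {d} {T : measurableType d} {R : realType}
    (P : probability T R) (g : T -> R) :
  measurable_fun setT g -> (forall x, `|g x| <= 1) ->
  P.-integrable setT (EFin \o g).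
Proof.
move=> mg g1; apply: measurable_bounded_integrable => //.
  exact: le_lt_trans (probability_le1 P measurableT) (ltry _).
by exists 1; split=> // M M1 x _ /=; rewrite (le_trans (g1 x))// ltW.
Qed.

(** Markov-type bound: [1 - g] is at least 1 where [g <= 0] and nonnegative elsewhere, so it
    dominates the indicator of [{g <= 0}]. *)
Lemma probability_le0_Rintegral {d} {T : measurableType d} {R : realType}
    (P : probability T R) (g : T -> R) :
  measurable_fun setT g -> (forall x, `|g x| <= 1) ->
  (P (g @^-1` `]-oo, 0%R]) <= (1 - \int[P]_x g x)%R%:E)%E.
Proof.
move=> mg g1; set A := g @^-1` _.
have mA : measurable A by rewrite -[A]setTI; exact: mg.
have ig := integrable_norm_le1 P g mg g1.
have i1 : P.-integrable setT (EFin \o cst (1 : R)).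
  exact: finite_measure_integrable_cst.
have -> : 1 - \int[P]_x g x = \int[P]_x (1 - g x).
  rewrite RintegralB//; congr (_ - _).
  have PT : (P : {measure set T -> \bar R}) setT = 1%E := probability_setT P.
  by rewrite Rintegral_cst// PT mul1r.
have -> : P A = (\int[P]_x (\1_A x))%:E.
  by rewrite /Rintegral integral_indic// setIT fineK// fin_num_measure.
rewrite lee_fin; apply: le_Rintegral => //.
- exact: integrable_indic.
- exact: (integrableB _ i1 ig).
- move=> x _; rewrite indicE; have := g1 x; rewrite ler_norml => /andP[_ gx].
  case: (boolP (x \in A)) => [/set_mem /=|_] /=.
    by rewrite /A /= in_itv /= => gx0; rewrite lerBrDr -lerBrDl subrr.
  by rewrite subr_ge0.
Qed.

Lemma mutually_singular_of_almost_separated {d} {T : measurableType d}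
    {R : realType} (mu nu : probability T R) :
  (forall e : R, 0 < e -> exists A, [/\ measurable A,
     (mu (~` A) <= e%:E)%E & (nu A <= e%:E)%E]) ->
  mutually_singular mu nu.
Proof.
move=> sep.
(* The errors [1 / 2 ^ n.+1] sum to 1, so Borel-Cantelli applies both to [A] under [nu] and to its
   complements under [mu]. *)
have /choice[A AP] n : exists A, [/\ measurable A,
    (mu (~` A) <= (1 / (2 ^ n.+1)%:R)%:E)%E &
    (nu A <= (1 / (2 ^ n.+1)%:R)%:E)%E].
  by apply: sep; rewrite divr_gt0// ltr0n expn_gt0.
have mA n : measurable (A n) by have [] := AP n.
have mL : measurable (lim_sup_set A).
  by apply: bigcap_measurable => // k _; exact: bigcup_measurable.
have nuL : nu (lim_sup_set A) = 0%E.
  apply: lim_sup_set_cvg0 => //; apply: (@le_lt_trans _ _ 1%E); last exact: ltry.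
  apply: le_trans (epsilon_trick0 xpredT ler01).
  by apply: lee_nneseries => // n _; have [] := AP n.
have muL : mu (lim_sup_set (fun n => ~` A n)) = 0%E.
  apply: lim_sup_set_cvg0 => [n|]; first exact: measurableC.
  apply: (@le_lt_trans _ _ 1%E); last exact: ltry.
  apply: le_trans (epsilon_trick0 xpredT ler01).
  by apply: lee_nneseries => // n _; have [] := AP n.
have muCL : mu (~` lim_sup_set A) = 0%E.
  apply: (subset_measure0 _ _ _ muL).
  - exact: measurableC.
  - apply: bigcap_measurable => // k _.
    by apply: bigcup_measurable => j _; exact: measurableC.
  (* A point outside the upper limit lies in no [A k] with [k >= n], hence in the complement of
     [A (maxn m n)] for every [m]. *)
  - rewrite /lim_sup_set setC_bigcap => x [n _ nAx] m _.
    exists (maxn m n); first exact: leq_maxl.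
    by move=> Ax; apply: nAx; exists (maxn m n) => //=; exact: leq_maxr.
exists (lim_sup_set A), (~` lim_sup_set A); split => //.
- exact: measurableC.
- exact: setICr.
- by rewrite -[lim_sup_set A]setCK probability_setC ?muCL ?sube0//; exact: measurableC.
- by rewrite probability_setC// nuL sube0.
Qed.

Lemma mutually_singular_of_test_functions {d} {T : measurableType d}
    {R : realType} (mu nu : probability T R) :
  (forall e : R, 0 < e -> exists g : T -> R, [/\ measurable_fun setT g,
     forall x, `|g x| <= 1 & 2 - e < `|\int[mu]_x g x - \int[nu]_x g x| ]) ->
  mutually_singular mu nu.
Proof.
move=> tests; apply: mutually_singular_of_almost_separated => e /tests.
move=> [g [mg g1 ge]].
have int1 (P : probability T R) (h : T -> R) : measurable_fun setT h ->
    (forall x, `|h x| <= 1) -> \int[P]_x - h x = - \int[P]_x h x.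
  move=> mh h1; under eq_Rintegral do rewrite -mulN1r.
  by rewrite RintegralZl ?mulN1r//; exact: integrable_norm_le1.
(* Passing to [- g] if necessary removes the absolute value. *)
have {g mg g1 ge} [g [mg g1 ge]] : exists g : T -> R, [/\ measurable_fun setT g,
     forall x, `|g x| <= 1 & 2 - e < \int[mu]_x g x - \int[nu]_x g x].
  case: (lerP 0 (\int[mu]_x g x - \int[nu]_x g x)) => [h|h].
    by exists g; split=> //; rewrite -(ger0_norm h).
  exists (fun x => - g x); split.
  - exact: measurableT_comp.
  - by move=> x; rewrite normrN.
  - by rewrite !int1//; move: ge; rewrite (ltr0_norm h); lra.
have g1N x : `|- g x| <= 1 by rewrite normrN.
have mgN : measurable_fun setT (fun x => - g x) by exact: measurableT_comp.
have bound (P : probability T R) (h : T -> R) : measurable_fun setT h ->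
    (forall x, `|h x| <= 1) -> \int[P]_x h x <= 1.
  move=> mh h1; have := probability_le0_Rintegral P h mh h1.
  by move=> /(le_trans (measure_ge0 _ _)); rewrite lee_fin subr_ge0.
have mu1 := bound mu g mg g1.
have nu1 := bound nu _ mgN g1N; rewrite int1// in nu1.
have mI (h : T -> R) (i : interval R) : measurable_fun setT h ->
    measurable (h @^-1` [set` i]).
  by move=> mh; rewrite -[X in measurable X]setTI; exact: mh.
(* Both integrals lie in [[-1, 1]], so a difference above [2 - e] forces the first above [1 - e] and
   the second below [e - 1]. The Markov-type bound is then used for [g] under [mu] and for [- g]
   under [nu]. *)
exists (g @^-1` `]0, +oo[); split; first exact: mI.
- rewrite preimage_setC setCitvr.
  apply: (le_trans (probability_le0_Rintegral mu g mg g1)).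
  by rewrite lee_fin; lra.
- apply: (@le_trans _ _ (nu ((fun x => - g x) @^-1` `]-oo, 0]))).
    apply: le_measure; rewrite ?inE; [exact: mI|exact: mI|].
    by move=> x /=; rewrite !in_itv/= andbT oppr_le0 => /ltW.
  apply: (le_trans (probability_le0_Rintegral nu _ mgN g1N)).
  by rewrite int1// lee_fin; lra.
Qed.

(** The two nested suprema are approximated in turn. As [sup] of the empty set is 0, [0 <= r] rules
    out an empty outer set; [x0] makes the inner one nonempty. *)
Lemma op_norm_gt (U : Type) (R : realType) (X : set (U -> R))
    (T : (U -> R) -> U -> R) (x0 : U) (r : R) :
  0 <= r -> r < op_norm X T ->
  exists f x, [/\ X f, sup_norm f <= 1 & r < `|T f x|].
Proof.
move=> r0 rT; have [|_ [f [Xf f1] <-]] := @sup_gt _ _ r _ rT.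
  apply/set0P/eqP => e; move: rT; rewrite /op_norm e sup0.
  by rewrite ltNge r0.
move=> /sup_gt[|_ [x _ <-] rx]; first by exists `|T f x0|, x0.
by exists f, x.
Qed.

Lemma le_sup_norm (U : Type) (R : realType) (f : U -> R) (x : U) :
  bounded_fun f -> `|f x| <= sup_norm f.
Proof.
move=> [M [_ fM]]; apply: ub_le_sup; last by exists x.
(* Boundedness provides a bound only at numbers strictly above [M], such as [|M| + 1]. *)
by exists (`|M| + 1) => _ [y _ <-]; apply: fM => //; rewrite ltr_pwDr// ler_norm.
Qed.

Theorem proposition2p7 (R : realType)
  (E : completeNormedModType R) (S : R -> E -> E) (A : set (E * E))
  (H : completeNormedModType R) (dot : {dot H for idfun}) (B : H -> E)
  (mu : R -> probability (borel E) R)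
  (hS : C0_semigroup S) (hA : A = generator S)
  (hH : induces_norm dot) (hB : bounded_operator B)
  (hmu : forall t, 0 <= t -> gaussian_radon (mu t) (covariance_operator dot S B t))
  (t s : R) (ht : 0 <= t) (hs : 0 <= s) (hSts : S t = S s)
  (hnorm : op_norm (BUC0 S mu) (fun f => OU S mu t f \- OU S mu s f) = 2) :
  mutually_singular (mu t) (mu s).
Proof.
apply: mutually_singular_of_test_functions => e e0.
have [|| f [x [[[bf cf] _] f1 fx]]] :=
  @op_norm_gt E R (BUC0 S mu) (fun f => OU S mu t f \- OU S mu s f) 0
    (Num.max 0 (2 - e)).
- by rewrite le_max lexx.
- by rewrite hnorm gt_max ltr0n/= ltrBlDr ltrDl.
(* Since [S t x = S s x], integrating this one function against [mu t] and [mu s] gives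
   [OU S mu t f x] and [OU S mu s f x]. *)
exists (fun y : borel E => f (S t x + y)); split.
- apply: (@continuous_borel_measurable R E (fun y => f (S t x + y))) => y.
  apply: continuous_comp; last exact: unif_continuous_continuous.
  by apply: cvgD; [exact: cvg_cst|exact: cvg_id].
- by move=> y; rewrite (le_trans _ f1)// le_sup_norm.
- move: fx; rewrite gt_max => /andP[_]; rewrite /OU /= -hSts; exact.
Qed.
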